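(* Let $\mathcal{N}(t)$, $t>0$, be a nonlinear pure birth process with pairwise distinct birth rates $\lambda_k>0$, $k\ge1$, and $\mathcal{N}(0)=1$. Let $\alpha\in(0,1]$ and let $\mathcal{S}^\alpha(t)$ be an $\alpha$-stable time independent of $\mathcal{N}$, with distribution $q_\alpha(t,s)$ having Laplace transform $\int_0^\infty e^{-\mu s}q_\alpha(t,s)\,ds=e^{-t\mu^\alpha}$. Then for every $t>0$ $$\Pr\{\mathcal{N}(\mathcal{S}^\alpha(t))=k\}=\begin{cases}\displaystyle\prod_{j=1}^{k-1}\lambda_j\sum_{m=1}^k\frac{e^{-t\lambda_m^\alpha}}{\prod_{l=1,l\neq m}^k(\lambda_l-\lambda_m)},&k>1,\\[2mm]e^{-t\lambda_1^\alpha},&k=1.\end{cases}$$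
   Context: The nonlinear pure birth process $\mathcal{N}(t)$ with rates $(\lambda_k)_{k\ge1}$ is the continuous-time Markov chain on $\{1,2,\dots\}$ started at $1$ which from state $k$ jumps only to $k+1$, at rate $\lambda_k$; it is assumed throughout that $\sum_k1/\lambda_k=\infty$ (no explosion). For $\alpha=1$, $\mathcal{S}^1(t)=t$. *)

(* Defs.v *)
From HB Require Import structures.
From mathcomp Require Import all_boot all_order all_algebra.
From mathcomp Require Import all_classical all_reals all_analysis.

Set Implicit Arguments.
Unset Strict Implicit.
Unset Printing Implicit Defensive.

Import Order.TTheory GRing.Theory Num.Theory.
Import numFieldNormedType.Exports.

Local Open Scope classical_set_scope.
Local Open Scope ring_scope.

(* [p t i j] is the probability of passing from [i] to [j] in a time [t]; only
   [0 <= t] and states of [E] are constrained. *)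
Definition is_transition_function (R : realType) (E : set nat)
    (p : R -> nat -> nat -> R) : Prop :=
  [/\ forall t i j, 0 <= t -> E i -> E j -> 0 <= p t i j,
      forall t i, 0 <= t -> E i -> (\esum_(j in E) (p t i j)%:E = 1)%E,
      forall i j, E i -> E j -> p 0 i j = (i == j)%:R &
      forall s t i j, 0 <= s -> 0 <= t -> E i -> E j ->
        ((p (s + t) i j)%:E = \esum_(k in E) (p s i k * p t k j)%:E)%E].

(* p'(0+) = q entrywise *)
Definition has_generator (R : realType) (E : set nat)
    (p : R -> nat -> nat -> R) (q : nat -> nat -> R) : Prop :=
  forall i j, E i -> E j ->
    h^-1 * (p h i j - (i == j)%:R) @[h --> 0^'+] --> q i j.

(* P (X_{t_{n+1}} = i_{n+1} | X_{t_0} = i_0, ..., X_{t_n} = i_n)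
     = p_{i_n, i_{n+1}} (t_{n+1} - t_n),
   multiplied out so that null conditioning events need no convention. *)
Definition markov_property d (Omega : measurableType d) (R : realType)
    (P : probability Omega R) (E : set nat) (p : R -> nat -> nat -> R)
    (X : R -> {RV P >-> nat}) : Prop :=
  forall (n : nat) (t : nat -> R) (i : nat -> nat),
    0 <= t 0%N ->
    (forall m, (m <= n)%N -> t m < t m.+1) ->
    (forall m, (m <= n.+1)%N -> E (i m)) ->
    (P [set w | forall m, (m <= n.+1)%N -> X (t m) w = i m] =
     P [set w | forall m, (m <= n)%N -> X (t m) w = i m]
       * (p (t n.+1 - t n) (i n) (i n.+1))%:E)%E.

(* Time-homogeneous continuous-time Markov chain with countable state space [E],
   Q-matrix [q] and initial state [x0].  Paths are right-continuous step
   functions ([E] is discrete). *)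
Definition is_ctmc d (Omega : measurableType d) (R : realType)
    (P : probability Omega R) (E : set nat) (q : nat -> nat -> R) (x0 : nat)
    (X : R -> {RV P >-> nat}) : Prop :=
  [/\ forall t w, 0 <= t -> E (X t w),
      forall t w, 0 <= t -> \forall s \near t^'+, X s w = X t w,
      P [set w | X 0 w = x0] = 1%E &
      exists p : R -> nat -> nat -> R,
        [/\ is_transition_function E p,
            has_generator E p q &
            markov_property E p X]].

Definition birth_generator (R : realType) (lambda : nat -> R) (i j : nat) : R :=
  if j == i then - lambda i else if j == i.+1 then lambda i else 0.

Definition is_pure_birth_process d (Omega : measurableType d) (R : realType)
    (P : probability Omega R) (lambda : nat -> R) (N : R -> {RV P >-> nat}) : Prop :=
  is_ctmc [set k : nat | (1 <= k)%N] (birth_generator lambda) 1%N N.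

Definition non_explosive (R : realType) (lambda : nat -> R) : Prop :=
  (\sum_(1 <= k <oo) ((lambda k)^-1)%:E = +oo)%E.

(* The law q_alpha(t, .) is the measure [distribution P (S t)]: for alpha < 1 it
   has a density, for alpha = 1 it is the Dirac mass at t, so that S t = t
   almost surely. *)
Definition is_stable_time d (Omega : measurableType d) (R : realType)
    (P : probability Omega R) (alpha : R) (S : R -> {RV P >-> R}) : Prop :=
  (forall t w, 0 <= t -> 0 <= S t w) /\
  (forall t mu, 0 < t -> 0 < mu ->
    (\int[distribution P (S t)]_(s in `[0%R, +oo[) (expR (- (mu * s)))%:E =
     (expR (- (t * mu `^ alpha)))%:E)%E).

(* The sigma-algebra sigma(X_t : t >= 0). *)
Definition process_sigma_algebra d d' (Omega : measurableType d)
    (T : measurableType d') (R : realType) (X : R -> Omega -> T)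
    : set (set Omega) :=
  <<s [set A | exists t B, [/\ 0 <= t, measurable B & A = X t @^-1` B]] >>.

Definition independent_processes d d1 d2 (Omega : measurableType d)
    (T1 : measurableType d1) (T2 : measurableType d2) (R : realType)
    (P : probability Omega R) (X : R -> Omega -> T1) (Y : R -> Omega -> T2)
    : Prop :=
  forall A B, process_sigma_algebra X A -> process_sigma_algebra Y B ->
    (P (A `&` B) = P A * P B)%E.

(* Main.v *)
(* The state probabilities of the birth process at a fixed time are the exponential
   sums [birth_prob k s]: they solve f_k' = lambda_{k-1} f_{k-1} - lambda_k f_k, with
   f_k(0) = [k = 1] by a partial fraction identity.  Keeping only the states k - 1
   and k in Chapman-Kolmogorov shows p_{1k} >= f_k.  The tails
   r_n = 1 - sum_{k <= n} f_k satisfy r_n' = lambda_n f_n, hence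
   sum_{n <= m} r_n(s) / lambda_n <= s; as sum 1 / lambda_n diverges, no mass can be
   missing from the f_k and p_{1k} = f_k.  Approximating S(t) from the right by
   grid-valued times, independence gives
   P(N(S(t)) = k) = E f_k(S(t)), a combination of Laplace transforms of S(t) at the
   rates lambda_m. *)
Require Import Defs.
From HB Require Import structures.
From mathcomp Require Import all_boot all_order all_algebra.
From mathcomp Require Import ring lra measurable_realfun.
From mathcomp Require Import all_classical all_reals all_analysis.

Set Implicit Arguments.
Unset Strict Implicit.
Unset Printing Implicit Defensive.

Import Order.TTheory GRing.Theory Num.Theory.
Import numFieldNormedType.Exports.

Local Open Scope classical_set_scope.
Local Open Scope ring_scope.

(** * Partial fractions at pairwise distinct nodes *)

Section partial_fractions.
Variables (K : fieldType) (a : nat -> K).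

(** For [1 <= m <= k] this is, up to sign, the derivative at [a m] of the polynomial
    [\prod_(1 <= l < k.+1) (a l - x)] in [x]; the inverses are the partial fraction coefficients. *)
Definition node_prod k m := \prod_(1 <= l < k.+1 | l != m) (a l - a m).

Lemma node_prodS k m : (m <= k)%N ->
  node_prod k.+1 m = node_prod k m * (a k.+1 - a m).
Proof.
move=> mk; rewrite /node_prod big_mkcond big_nat_recr//= -big_mkcond/=.
by rewrite gtn_eqF ?ltnS.
Qed.

Lemma node_prod_last k :
  node_prod k.+1 k.+1 = \prod_(1 <= l < k.+1) (a l - a k.+1).
Proof.
rewrite /node_prod big_mkcond big_nat_recr//= eqxx mulr1 -big_mkcond/=.
rewrite big_nat_cond [RHS]big_nat_cond; apply: eq_bigl => l.
rewrite andbT; case lk: (_ <= _ < _)%N => //=.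
by rewrite ltn_eqF//; case/andP: lk.
Qed.

Hypothesis a_inj : forall i j, (1 <= i)%N -> (1 <= j)%N -> i <> j -> a i <> a j.

Let a_subr i j : (1 <= i)%N -> (1 <= j)%N -> i != j -> a i - a j != 0.
Proof. by move=> i1 j1 /eqP ij; rewrite subr_eq0; apply/eqP/a_inj. Qed.

(** The assumed identity is taken at [x = a k.+1]. Having it as a premise lets the result serve both
    inside the induction that proves the identity and after it. *)
Let sum_node_last k : (0 < k)%N ->
  (forall x, (forall l, (1 <= l <= k)%N -> a l != x) ->
    \sum_(1 <= m < k.+1) (node_prod k m)^-1 / (a m - x) =
    (\prod_(1 <= l < k.+1) (a l - x))^-1) ->
  \sum_(1 <= m < k.+1) (node_prod k.+1 m)^-1 = - (node_prod k.+1 k.+1)^-1.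
Proof.
move=> k0 pf; rewrite node_prod_last -pf; last first.
  move=> l /andP[l1 lk]; apply/eqP/a_inj => //.
  by move=> e; rewrite e ltnn in lk.
rewrite -sumrN; apply: eq_big_nat => m /andP[m1 mk].
by rewrite node_prodS// invfM -opprB invrN mulrN.
Qed.

Lemma partial_fractions k x : (0 < k)%N ->
  (forall l, (1 <= l <= k)%N -> a l != x) ->
  \sum_(1 <= m < k.+1) (node_prod k m)^-1 / (a m - x) =
  (\prod_(1 <= l < k.+1) (a l - x))^-1.
Proof.
case: k => // k _; elim: k x => [|k IH] x ax.
  by rewrite !big_nat1 /node_prod big_mkcond big_nat1 eqxx invr1 mul1r.
have Hb : a k.+2 - x != 0 by rewrite subr_eq0 ax//= leqnn.
rewrite big_nat_recr//=.
(* With [b = a k.+2] and [c = a m], each term is split by 1/((b - c)(c - x)) = (1/(b - c) + 1/(c -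
   x))/(b - x). The first sum will cancel the isolated last term. *)
have -> : \sum_(1 <= m < k.+2) (node_prod k.+2 m)^-1 / (a m - x) =
  (\sum_(1 <= m < k.+2) (node_prod k.+2 m)^-1
   + \sum_(1 <= m < k.+2) (node_prod k.+1 m)^-1 / (a m - x)) / (a k.+2 - x).
  rewrite -big_split mulr_suml; apply: eq_big_nat => m /andP[m1 mk].
  rewrite node_prodS// invfM /=.
  have H1 : a k.+2 - a m != 0 by rewrite a_subr// gtn_eqF.
  have H2 : a m - x != 0 by rewrite subr_eq0 ax// m1 /= ltnW.
  move: (_^-1) => c; field.
  by rewrite H1 H2 Hb.
rewrite (sum_node_last _ IH)// IH; last first.
  by move=> l /andP[l1 lk]; rewrite ax// l1 ltnW.
rewrite -mulrDl addrAC addNr add0r [in RHS]big_nat_recr//= invfM.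
by [].
Qed.

Lemma sum_node_prodV k : (1 < k)%N ->
  \sum_(1 <= m < k.+1) (node_prod k m)^-1 = 0.
Proof.
case: k => [|[|k]]// _; rewrite big_nat_recr//= sum_node_last ?addNr//.
by move=> x; apply: partial_fractions.
Qed.
End partial_fractions.

(** * Exponential sums and their forward equations *)

Lemma expRN_expansion (R : realType) (x : R) : 0 <= x ->
  `|expR (- x) - (1 - x)| <= x ^+ 2.
Proof.
move=> x0; have H1 := expR_ge1Dx (- x); have H2 := expR_ge1Dx x.
have H3 := expRxMexpNx_1 x; have H4 := expR_gt0 (- x).
rewrite ger0_norm ?subr_ge0//.
rewrite lerBlDr -(ler_pM2r (expR_gt0 x)) mulrC H3.
(* What remains is [1 <= (x^2 + 1 - x) * expR x]; it follows from [expR x >= 1 + x] because (1 +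
   x)(1 - x + x^2) = 1 + x^3. *)
nra.
Qed.

Section birth_probability.
Variables (R : realType) (lambda : nat -> R).
Hypothesis lambda_gt0 : forall k, (1 <= k)%N -> 0 < lambda k.
Hypothesis lambda_distinct : forall i j, (1 <= i)%N -> (1 <= j)%N ->
  i <> j -> lambda i <> lambda j.

Definition birth_coef k m :=
  (\prod_(1 <= j < k) lambda j) / node_prod lambda k m.

Definition birth_prob k s :=
  \sum_(1 <= m < k.+1) birth_coef k m * expR (- (lambda m * s)).

(** With this convention for the absent state 0, the equations for state 1 are the general ones,
    whatever [lambda 0] is. *)
Lemma birth_prob0 s : birth_prob 0 s = 0.
Proof. by rewrite /birth_prob big_geq. Qed.

Lemma birth_prob_init k : (1 <= k)%N -> birth_prob k 0 = (k == 1%N)%:R.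
Proof.
move=> k1; rewrite /birth_prob.
under eq_bigr do rewrite mulr0 oppr0 expR0 mulr1.
rewrite -mulr_sumr; have [->|kn1] := eqVneq k 1%N.
  by rewrite big_geq// big_nat1 /node_prod big_mkcond big_nat1 eqxx invr1 mulr1.
by rewrite sum_node_prodV ?mulr0// ltn_neqAle eq_sym kn1.
Qed.

(** The forward equation read on the coefficient of [expR (- (lambda m * s))]. *)
Lemma birth_coefS k m : (1 <= m <= k)%N ->
  (lambda k.+1 - lambda m) * birth_coef k.+1 m = lambda k * birth_coef k m.
Proof.
move=> /andP[m1 mk]; rewrite /birth_coef node_prodS//.
have k1 : (1 <= k)%N by exact: leq_trans mk.
rewrite big_nat_recr//= invfM.
have d0 : lambda k.+1 - lambda m != 0.
  rewrite subr_eq0; apply/eqP/lambda_distinct => //.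
  by move=> e; rewrite -e ltnn in mk.
by move: (node_prod _ _ _)^-1 => N; field.
Qed.

(** The left side is the termwise derivative of [birth_prob k.+1]; its term [m = k.+1] comes from
    the outflow alone. *)
Lemma birth_prob_deriv k s :
  - \sum_(1 <= m < k.+2) lambda m * (birth_coef k.+1 m * expR (- (lambda m * s)))
  = lambda k * birth_prob k s - lambda k.+1 * birth_prob k.+1 s.
Proof.
rewrite /birth_prob !mulr_sumr [in X in _ = _ - X]big_nat_recr//= big_nat_recr//=.
rewrite !opprD addrA; congr (_ - _).
rewrite -!sumrN -big_split/=; apply: eq_big_nat => m mk.
by rewrite [lambda k * _]mulrA -birth_coefS//; ring.
Qed.

(** The Euler scheme needs a remainder uniform in [s]: pulling [expR (- (lambda m * s)) <= 1] out of
    each term leaves [expRN_expansion] at [lambda m * h]. *)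
Lemma birth_prob_expansion k : exists2 C : R, 0 <= C & forall s h, 0 <= s -> 0 <= h ->
  `|birth_prob k.+1 (s + h) -
    (birth_prob k.+1 s +
     h * (lambda k * birth_prob k s - lambda k.+1 * birth_prob k.+1 s))|
  <= C * h ^+ 2.
Proof.
exists (\sum_(1 <= m < k.+2) `|birth_coef k.+1 m| * lambda m ^+ 2).
  by apply: sumr_ge0 => m _; rewrite mulr_ge0// sqr_ge0.
move=> s h s0 h0; rewrite -birth_prob_deriv mulrN mulr_sumr /birth_prob.
rewrite -sumrB -sumrB mulr_suml.
apply: (le_trans (ler_norm_sum _ _ _)).
rewrite big_nat_cond [leRHS]big_nat_cond.
apply: ler_sum => m /andP[/andP[m1 _] _].
have lm := ltW (lambda_gt0 m1).
rewrite (_ : _ - _ = birth_coef k.+1 m * expR (- (lambda m * s)) *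
   (expR (- (lambda m * h)) - (1 - lambda m * h))); last first.
  by rewrite mulrDr opprD expRD; ring.
move: (birth_coef k.+1 m) => c.
rewrite 2!normrM -mulrA -[leRHS]mulrA -exprMn.
rewrite ler_wpM2l// ger0_norm ?expR_ge0// -[leRHS]mul1r.
rewrite ler_pM ?expR_ge0//.
  by rewrite -[leRHS]expR0 ler_expR oppr_le0 mulr_ge0.
by rewrite expRN_expansion// mulr_ge0.
Qed.
End birth_probability.

(* An Euler-scheme comparison: over [n] steps of length [t / n] the local errors
   [e * h] add up to at most [e * t]. *)
Lemma euler_comparison (R : realType) (u : R -> R) :
  0 <= u 0 ->
  (forall e, 0 < e -> \forall h \near 0^'+, forall s, 0 <= s ->
    exists2 a, 0 <= a <= 1 & a * u s - e * h <= u (s + h)) ->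
  forall t, 0 <= t -> 0 <= u t.
Proof.
move=> u0 ustep t; rewrite le_eqVlt => /predU1P[<-//|t0].
rewrite leNgt; apply/negP => ut.
(* The accumulated error [e * t] is then [- u t / 2], too small to reach [u t]. *)
pose e := - u t / (2 * t).
have e0 : 0 < e by rewrite divr_gt0 ?oppr_gt0// mulr_gt0.
have [dl /= dl0 Hd] := ustep _ e0.
pose n := Num.truncn (t / dl).
pose h := t / n.+1%:R.
have h0 : 0 < h by rewrite divr_gt0.
have hd : h < dl.
  rewrite /h ltr_pdivrMr// mulrC -ltr_pdivrMr//.
  by have /andP[] := truncn_itv (divr_ge0 (ltW t0) (ltW dl0)).
have Hu s : 0 <= s -> exists2 a, 0 <= a <= 1 & a * u s - e * h <= u (s + h).
  apply: (Hd h) => //=.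
  by rewrite sub0r normrN gtr0_norm.
have H m : - (e * (m%:R * h)) <= u (m%:R * h).
  elim: m => [|m IH]; first by rewrite mul0r mulr0 oppr0.
  have mh : 0 <= m%:R * h by rewrite mulr_ge0// ltW.
  have [a /andP[a0 a1] Ha] := Hu _ mh.
  rewrite -natr1 mulrDl mul1r; apply: le_trans Ha.
  (* A factor [a] between 0 and 1 cannot worsen a nonpositive lower bound. *)
  have emh : 0 <= e * (m%:R * h) by rewrite mulr_ge0// ltW.
  nra.
have := H n.+1; rewrite (_ : n.+1%:R * h = t); last by rewrite /h mulrC divfK.
have -> : e * t = - u t / 2 by rewrite /e; field; rewrite gt_eqF.
lra.
Qed.

(** * Lower bound for the transition probabilities out of state 1 *)

Section birth_transition.
Variables (R : realType) (lambda : nat -> R).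
Hypothesis lambda_gt0 : forall k, (1 <= k)%N -> 0 < lambda k.
Hypothesis lambda_distinct : forall i j, (1 <= i)%N -> (1 <= j)%N ->
  i <> j -> lambda i <> lambda j.

Lemma birth_prob_bounded k : exists2 M : R, 0 <= M & forall s, 0 <= s ->
  `|birth_prob lambda k s| <= M.
Proof.
exists (\sum_(1 <= m < k.+1) `|birth_coef lambda k m|).
  by apply: sumr_ge0.
move=> s s0; apply: (le_trans (ler_norm_sum _ _ _)).
rewrite big_nat_cond [leRHS]big_nat_cond.
apply: ler_sum => m /andP[/andP[m1 _] _].
rewrite normrM -[leRHS]mulr1 ler_wpM2l// ger0_norm ?expR_ge0//.
by rewrite -[leRHS]expR0 ler_expR oppr_le0 mulr_ge0// ltW// lambda_gt0.
Qed.

Variable p : R -> nat -> nat -> R.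
Let E := [set k : nat | (1 <= k)%N].
Hypothesis ptf : is_transition_function E p.
Hypothesis pgen : has_generator E p (birth_generator lambda).

Lemma transition_ge0 s i j : 0 <= s -> (1 <= i)%N -> (1 <= j)%N -> 0 <= p s i j.
Proof. by case: ptf => H _ _ _ s0 i1 j1; exact: H. Qed.

Lemma partial_sum_le_esum (F : nat -> R) x n : (forall k, (1 <= k)%N -> 0 <= F k) ->
  (x%:E = \esum_(k in E) (F k)%:E)%E -> \sum_(1 <= k < n) F k <= x.
Proof.
move=> F0 xF; rewrite -lee_fin xF -nneseries_esum; last first.
  by move=> k k1; rewrite lee_fin F0.
have -> : (\sum_(1 <= k < n) F k)%:E = (\sum_(0 <= k < n | (1 <= k)%N) (F k)%:E)%E.
  rewrite sumEFin; congr EFin.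
  case: n => [|n]; first by rewrite !big_geq.
  by rewrite [RHS]big_mkcond big_nat_recl//= add0r big_add1.
by apply: nneseries_lim_ge => k _ k1; rewrite lee_fin F0.
Qed.

Lemma transition_row_le1 s i n : 0 <= s -> (1 <= i)%N ->
  \sum_(1 <= k < n) p s i k <= 1.
Proof.
move=> s0 i1; apply: partial_sum_le_esum => [k k1|]; first exact: transition_ge0.
by case: ptf => _ /(_ s i s0 i1) ->.
Qed.

Lemma transition_le1 s i j : 0 <= s -> (1 <= i)%N -> (1 <= j)%N -> p s i j <= 1.
Proof.
move=> s0 i1 j1; apply: le_trans (transition_row_le1 j.+1 s0 i1).
rewrite big_nat_recr//= lerDr big_nat_cond sumr_ge0// => k.
by move=> /andP[/andP[k1 _] _]; exact: transition_ge0.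
Qed.

(* Chapman-Kolmogorov, keeping only the intermediate states [k] and [k.+1]. *)
Lemma transition_ge_two s h i k : 0 <= s -> 0 <= h -> (1 <= i)%N ->
  (0 < k)%:R * p s i k * p h k k.+1 + p s i k.+1 * p h k.+1 k.+1 <= p (s + h) i k.+1.
Proof.
move=> s0 h0 i1; have [_ _ _ /(_ s h i k.+1 s0 h0 i1 isT) ck] := ptf.
have F0 j : (1 <= j)%N -> 0 <= p s i j * p h j k.+1.
  by move=> j1; rewrite mulr_ge0 ?transition_ge0.
apply: le_trans (partial_sum_le_esum k.+2 F0 ck).
(* For [k = 0] the intermediate state lies outside [E] and its term is killed by the factor
   [(0 < k)%:R]. *)
rewrite big_nat_recr//= lerD2r; case: k {ck} F0 => [|k] F0.
  by rewrite !mul0r big_geq.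
rewrite mul1r big_nat_recr//= lerDr big_nat_cond sumr_ge0// => j.
by move=> /andP[/andP[j1 _] _]; exact: F0.
Qed.

Lemma generator_near i j e : (1 <= i)%N -> (1 <= j)%N -> 0 < e ->
  \forall h \near 0^'+,
    `|p h i j - ((i == j)%:R + birth_generator lambda i j * h)| <= e * h.
Proof.
move=> i1 j1 e0; have /cvgrPdist_le /(_ e e0) H := pgen i1 j1.
near=> h; have h0 : 0 < h by near: h; exact: nbhs_right_gt.
have : `|birth_generator lambda i j - h^-1 * (p h i j - (i == j)%:R)| <= e.
  by near: h; exact: H.
set z := _ - _ => zle.
have -> : p h i j - ((i == j)%:R + birth_generator lambda i j * h) = - z * h.
  by rewrite /z; field; rewrite gt_eqF.
by rewrite normrM normrN (gtr0_norm h0) ler_pM2r.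
Unshelve. all: by end_near. Qed.

(** Induction on the state: the difference [u] of the two sides at [k.+1] vanishes at time 0 and
    satisfies the Euler step with factor [p h k.+1 k.+1], the inflow from [k] being controlled by
    the induction hypothesis. *)
Lemma birth_prob_le_transition k s : 0 <= s ->
  birth_prob lambda k s <= (0 < k)%:R * p s 1 k.
Proof.
elim: k s => [|k IH] s s0; first by rewrite birth_prob0 mul0r.
rewrite mul1r -subr_ge0; pose u s := p s 1 k.+1 - birth_prob lambda k.+1 s.
rewrite -/(u s); apply: euler_comparison s s0; rewrite /u.
  have [_ _ /(_ 1%N k.+1 isT isT) -> _] := ptf.
  by rewrite birth_prob_init// eq_sym subrr.
move=> e e0.
have [M M0 HM] := birth_prob_bounded k.+1.
have [C C0 HC] := birth_prob_expansion lambda_gt0 lambda_distinct k.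
(* The local error [e * h] is shared in thirds between the diagonal entry, the entry from [k] to
   [k.+1] and the remainder [C * h ^+ 2]. Adding 1 to [M] and [C] keeps the denominators
   positive. *)
have e1 : 0 < e / (3 * (M + 1)) by rewrite divr_gt0// mulr_gt0//; lra.
have e2 : 0 < e / 3 by rewrite divr_gt0.
have e3 : 0 < e / (3 * (C + 1)) by rewrite divr_gt0// mulr_gt0//; lra.
near=> h => s s0.
have h0 : 0 < h by near: h; exact: nbhs_right_gt.
have hC : C * h ^+ 2 <= e / 3 * h.
  rewrite expr2 mulrA ler_pM2r//.
  have : h <= e / (3 * (C + 1)) by near: h; exact: nbhs_right_le.
  by rewrite ler_pdivlMr ?mulr_gt0//; [nra|lra].
have hA : `|p h k.+1 k.+1 - (1 - lambda k.+1 * h)| <= e / (3 * (M + 1)) * h.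
  near: h; have := generator_near (ltn0Sn k) (ltn0Sn k) e1.
  by apply: filterS => h; rewrite /birth_generator eqxx mulNr.
have hB : (0 < k)%:R * (lambda k * h - p h k k.+1) <= e / 3 * h.
  near: h; case: k {IH u HM HC} => [|k] in e2 *.
    near=> h; rewrite mul0r mulr_ge0// ltW//.
  have := generator_near (ltn0Sn k) (ltn0Sn k.+1) e2.
  apply: filterS => h; rewrite /birth_generator ltn_eqF// gtn_eqF// eqxx add0r mul1r.
  by rewrite distrC => /(le_trans (ler_norm _)).
exists (p h k.+1 k.+1); first by rewrite transition_ge0 ?transition_le1// ltW.
(* After Chapman-Kolmogorov, [u (s + h) - a * u s] is at least this product plus the quantity in
   [off], minus the remainder. *)
have diag : - (e / 3 * h) <= birth_prob lambda k.+1 s *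
    (p h k.+1 k.+1 - (1 - lambda k.+1 * h)).
  apply: (@le_trans _ _ (- (M * (e / (3 * (M + 1)) * h)))).
    rewrite lerN2 (_ : M * _ = (M / (M + 1)) * (e / 3 * h)); last first.
      by field; lra.
    have M1 : M / (M + 1) <= 1 by rewrite ler_pdivrMr ?mul1r; lra.
    have eh : 0 <= e / 3 * h by rewrite mulr_ge0// ltW.
    by rewrite ler_piMl.
  suff /ler_normlP[] : `|birth_prob lambda k.+1 s *
      (p h k.+1 k.+1 - (1 - lambda k.+1 * h))| <= M * (e / (3 * (M + 1)) * h).
    by rewrite lerNl.
  by rewrite normrM ler_pM// HM.
have off : - (e / 3 * h) <= (0 < k)%:R * p s 1 k * p h k k.+1
    - h * (lambda k * birth_prob lambda k s).
  move: hB (IH s s0); case: (k) => [_ _|k'].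
    by rewrite birth_prob0 !(mul0r, mulr0) subr0 oppr_le0 mulr_ge0// ltW.
  rewrite !mul1r => hB fp.
  have := transition_ge0 s0 (leqnn 1) (ltn0Sn k'); have := transition_le1 s0 (leqnn 1) (ltn0Sn k').
  move=> p1 p0; have lk := lambda_gt0 (ltn0Sn k').
  (* The quantity is this nonnegative term plus [p s 1 k'.+1] times the generator error, a factor
     between 0 and 1. *)
  have : 0 <= h * lambda k'.+1 * (p s 1 k'.+1 - birth_prob lambda k'.+1 s).
    by rewrite mulr_ge0 ?subr_ge0// mulr_ge0// ltW.
  have eh : 0 <= e / 3 * h by rewrite mulr_ge0// ltW.
  nra.
have tr := transition_ge_two k s0 (ltW h0) (leqnn 1).
have /(le_trans (ler_norm _)) exp_le := HC s h s0 (ltW h0).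
lra.
Unshelve. all: by end_near. Qed.

(** * Tails of the exponential sums and exclusion of lost mass *)

Let birth_tail n s := 1 - \sum_(1 <= j < n.+1) birth_prob lambda j s.

(** Summed over the states up to [n], the forward equations telescope to the flow out of [n]. *)
Let birth_tail_expansion n : exists2 C : R, 0 <= C & forall s h, 0 <= s -> 0 <= h ->
  birth_tail n (s + h) <=
  birth_tail n s + h * (lambda n * birth_prob lambda n s) + C * h ^+ 2.
Proof.
rewrite /birth_tail; elim: n => [|n [C C0 IH]].
  exists 0 => // s h _ _.
  by rewrite !big_geq// birth_prob0 mulr0 mulr0 mul0r !addr0.
have [C' C'0 HC] := birth_prob_expansion lambda_gt0 lambda_distinct n.
exists (C + C'); first exact: addr_ge0.
move=> s h s0 h0; rewrite big_nat_recr//= [in leRHS]big_nat_recr//=.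
have /ler_normlP[exp_ge _] := HC s h s0 h0.
have tail_le := IH s h s0 h0.
lra.
Qed.

Let birth_tail_sum m s := \sum_(1 <= n < m.+1) birth_tail n s / lambda n.

(** Dividing by [lambda n] turns the growth rate of each tail into [birth_prob lambda n], so the
    weighted sum grows at the total mass of the first [m] states. *)
Let birth_tail_sum_expansion m : exists2 C : R, 0 <= C &
  forall s h, 0 <= s -> 0 <= h ->
  birth_tail_sum m (s + h) <= birth_tail_sum m s
    + h * \sum_(1 <= n < m.+1) birth_prob lambda n s + C * h ^+ 2.
Proof.
rewrite /birth_tail_sum; elim: m => [|m [C C0 IH]].
  by exists 0 => // s h _ _; rewrite !big_geq// mulr0 mul0r !addr0.
have [C' C'0 HC] := birth_tail_expansion m.+1.
have lm := lambda_gt0 (ltn0Sn m).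
exists (C + C' / lambda m.+1); first by rewrite addr_ge0// divr_ge0// ltW.
move=> s h s0 h0; rewrite [leLHS]big_nat_recr//= [X in X + _ + _]big_nat_recr//=.
rewrite [X in h * X]big_nat_recr//=.
have := HC s h s0 h0; rewrite -(ler_pM2r (_ : 0 < (lambda m.+1)^-1)) ?invr_gt0//.
rewrite !mulrDl (_ : h * _ / _ = h * birth_prob lambda m.+1 s); last first.
  by field; rewrite gt_eqF.
have := IH s h s0 h0.
rewrite [C' * _ / _]mulrAC.
move: (_ / lambda m.+1) (_ / lambda m.+1) (C' / _) => x y z.
lra.
Qed.

Let birth_prob_le k s : (1 <= k)%N -> 0 <= s -> birth_prob lambda k s <= p s 1 k.
Proof.
by move=> k1 s0; have := birth_prob_le_transition k s0; rewrite k1 mul1r.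
Qed.

(** That growth rate is at most 1, since the exponential sums lie below a row of [p]; all tails
    involved vanish at time 0. The Euler comparison applies with factor 1. *)
Let birth_tail_sum_le m s : 0 <= s -> birth_tail_sum m s <= s.
Proof.
move=> s0; rewrite -subr_ge0; pose u s := s - birth_tail_sum m s.
rewrite -/(u s); apply: euler_comparison s s0; rewrite /u.
  rewrite /birth_tail_sum big_nat_cond big1 ?subr0// => n /andP[/andP[n1 _] _].
  rewrite /birth_tail big_ltn// birth_prob_init// big_nat_cond big1 ?addr0 ?subrr ?mul0r//.
  move=> j /andP[/andP[j1 _] _]; rewrite birth_prob_init ?(ltnW j1)//.
  by rewrite gtn_eqF.
move=> e e0; have [C C0 HC] := birth_tail_sum_expansion m.
have e1 : 0 < e / (C + 1) by rewrite divr_gt0//; lra.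
near=> h => s s0.
have h0 : 0 < h by near: h; exact: nbhs_right_gt.
have hC : C * h ^+ 2 <= e * h.
  rewrite expr2 mulrA ler_pM2r//.
  have : h <= e / (C + 1) by near: h; exact: nbhs_right_le.
  by rewrite ler_pdivlMr; [nra|lra].
exists 1; first by rewrite ler01 lexx.
have tail_le := HC s h s0 (ltW h0).
have : h * \sum_(1 <= n < m.+1) birth_prob lambda n s <= h.
  rewrite ler_piMr ?(ltW h0)//.
  apply: le_trans (transition_row_le1 m.+1 s0 (leqnn 1)).
  by apply: ler_sum_nat => n /andP[n1 _]; exact: birth_prob_le.
lra.
Unshelve. all: by end_near. Qed.

Hypothesis lambda_non_explosive : non_explosive lambda.

(** A deficit [c > 0] at state [k] stays in every tail with [n >= k], so [c] times the sum of
    [1 / lambda n] from [k] on is at most [s], against divergence. *)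
Lemma birth_transitionE k s : (1 <= k)%N -> 0 <= s ->
  p s 1 k = birth_prob lambda k s.
Proof.
move=> k1 s0; apply/eqP; rewrite eq_le birth_prob_le// andbT leNgt.
apply/negP; rewrite -subr_gt0; set c := _ - _ => c0.
(* The tail is the mass of the row of [p] beyond [n] plus the deficits of the states up to [n], both
   nonnegative. *)
have tail_eq n : birth_tail n s = (1 - \sum_(1 <= j < n.+1) p s 1 j)
    + \sum_(1 <= j < n.+1) (p s 1 j - birth_prob lambda j s).
  by rewrite /birth_tail sumrB; ring.
have tail_ge0 n : 0 <= birth_tail n s.
  rewrite tail_eq addr_ge0 ?subr_ge0 ?transition_row_le1// big_nat_cond.
  by apply: sumr_ge0 => j /andP[/andP[j1 _] _]; rewrite subr_ge0 birth_prob_le.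
have tail_gec n : (k <= n)%N -> c <= birth_tail n s.
  move=> kn; rewrite tail_eq -[leLHS]add0r lerD ?subr_ge0 ?transition_row_le1//.
  rewrite (bigD1_seq k) ?iota_uniq ?mem_index_iota ?k1//= lerDl big_nat_cond.
  apply: sumr_ge0 => j /andP[/andP[j1 _] _].
  by rewrite subr_ge0 birth_prob_le.
have bound m : (k <= m)%N ->
    \sum_(1 <= n < m.+1) (lambda n)^-1 <= \sum_(1 <= n < k) (lambda n)^-1 + s / c.
  move=> km; rewrite (@big_cat_nat _ _ _ k)//= ?(leq_trans km)// lerD2l.
  rewrite ler_pdivlMr//; apply: le_trans (birth_tail_sum_le m s0).
  rewrite /birth_tail_sum [leRHS](@big_cat_nat _ _ _ k)//= ?(leq_trans km)//.
  rewrite mulr_suml -[leLHS]add0r lerD//.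
    rewrite big_nat_cond; apply: sumr_ge0 => n /andP[/andP[n1 _] _].
    by rewrite divr_ge0// ltW// lambda_gt0.
  apply: ler_sum_nat => n /andP[kn _].
  by rewrite mulrC ler_pM2r ?tail_gec// invr_gt0 lambda_gt0// (leq_trans k1).
suff : (\sum_(1 <= k <oo) ((lambda k)^-1)%:E <=
    (\sum_(1 <= n < k) (lambda n)^-1 + s / c)%:E)%E by rewrite lambda_non_explosive.
apply: lime_le.
  by apply: is_cvg_nneseries => n n1 _; rewrite lee_fin invr_ge0 ltW// lambda_gt0.
near=> m; rewrite sumEFin lee_fin.
have : (k < m)%N by near: m; exact: nbhs_infty_gt.
by case: (m) => // m'; rewrite ltnS => /bound.
Unshelve. all: by end_near. Qed.
End birth_transition.

(** * Evaluation at an independent random time *)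

Lemma birth_prob_continuous (R : realType) (lambda : nat -> R) k :
  continuous (birth_prob lambda k).
Proof.
move=> s; rewrite /birth_prob; apply: (@cvg_big _ _ +%R 0) => [|m _]; first exact: add_continuous.
apply: cvgM; first exact: cvg_cst.
apply: continuous_comp; last exact: continuous_expR.
by apply: cvgN; apply: cvgM; [exact: cvg_cst|exact: cvg_id].
Qed.

Lemma measurable_fun_nat d (T : measurableType d) (J : T -> nat) :
  (forall j, measurable [set w | J w = j]) -> measurable_fun setT J.
Proof.
move=> mJ _ Y _; rewrite setTI.
have -> : J @^-1` Y = \bigcup_(j in Y) [set w | J w = j].
  apply/seteqP; split=> [w Yw|w [j Yj /= Jw]] /=; last by rewrite Jw.
  by exists (J w).
by apply: bigcup_measurable => j _.
Qed.

(** Here [F j] acts as the conditional probability of [A j] given [J = j]; both sides are split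
    along the countably many level sets of [J]. *)
Lemma probability_at_nat_time d (Omega : measurableType d) (R : realType)
    (P : probability Omega R) (J : Omega -> nat) (A : nat -> set Omega)
    (F : nat -> R) :
  (forall j, measurable [set w | J w = j]) -> (forall j, measurable (A j)) ->
  (forall j, 0 <= F j) ->
  (forall j, P ([set w | J w = j] `&` A j) = P [set w | J w = j] * (F j)%:E)%E ->
  measurable [set w | A (J w) w] /\
  P [set w | A (J w) w] = (\int[P]_w (F (J w))%:E)%E.
Proof.
move=> mJ mA F0 PF.
have AE : [set w | A (J w) w] = \bigcup_j ([set w | J w = j] `&` A j).
  apply/seteqP; split=> [w Aw|w [j _ [/= Jw]]] /=; last by rewrite Jw.
  by exists (J w).
have Jtriv : trivIset setT (fun j => [set w | J w = j]).
  apply/trivIsetP => i j _ _ ij; rewrite -subset0 => w [/= wi wj].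
  by move/eqP: ij; rewrite -wi -wj.
have JT : \bigcup_j [set w | J w = j] = [set: Omega].
  by rewrite -subTset => w _; exists (J w).
have mJA j : measurable ([set w | J w = j] `&` A j) by exact: measurableI.
rewrite AE; split; first exact: bigcup_measurable.
rewrite measure_semi_bigcup//; last 2 first.
- exact: trivIset_setIr.
- exact: bigcup_measurable.
rewrite -JT ge0_integral_bigcup//; last 2 first.
- rewrite JT; apply/measurable_EFinP.
  by apply: (measurableT_comp (f := F)) => //; exact: measurable_fun_nat.
- by move=> w _; rewrite lee_fin.
apply: eq_eseriesr => j _; apply: (etrans (PF j)).
rewrite muleC -integral_cst//.
by apply: eq_integral => w; rewrite inE/= => ->.
Qed.

(* The upper grid points [(floor (n x) + 1) / n] decrease to [x] from strictly above,
   so right-continuity of the paths passes the identity from grid times to [T]. *)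
Lemma probability_time_change d (Omega : measurableType d) (R : realType)
    (P : probability Omega R) (N : R -> {RV P >-> nat}) (T : {RV P >-> R})
    (f : R -> R) (k : nat) :
  (forall w, 0 <= T w) ->
  (forall (u : R) w, 0 <= u -> \forall v \near u^'+, N v w = N u w) ->
  continuous f -> (forall u, 0 <= u -> 0 <= f u <= 1) ->
  (forall (u : R) B, 0 < u -> measurable B ->
    (P (T @^-1` B `&` [set w | N u w = k]) = P (T @^-1` B) * (f u)%:E)%E) ->
  P [set w | N (T w) w = k] = (\int[P]_w (f (T w))%:E)%E.
Proof.
move=> T0 Nright fcont f01 indep.
pose J n w := Num.truncn (T w * n.+1%:R).
(* The successor puts the grid time strictly above [T w], as the punctured filter [u^'+] requires,
   and makes it positive, as the independence premise requires. *)
pose g n j : R := j.+1%:R / n.+1%:R.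
have g0 n j : 0 < g n j by rewrite divr_gt0.
have JP n w : (J n w)%:R <= T w * n.+1%:R < (J n w).+1%:R.
  by apply: Num.Theory.truncn_itv; rewrite mulr_ge0.
have gT n w : T w < g n (J n w).
  by rewrite ltr_pdivlMr//; case/andP: (JP n w).
have gTn n w : g n (J n w) <= T w + n.+1%:R^-1.
  rewrite ler_pdivrMr// mulrDl mulVf// -natr1 lerD2r.
  by case/andP: (JP n w).
have gcvg w : g n (J n w) @[n --> \oo] --> T w.
  apply: (@squeeze_cvgr _ _ _ _ (cst (T w)) (fun n => T w + n.+1%:R^-1)).
  - by apply: nearW => n; rewrite ltW//= gTn.
  - exact: cvg_cst.
  - rewrite -[X in _ --> X]addr0; apply: cvgD; first exact: cvg_cst.
    exact: cvg_harmonic.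
have JE n j : [set w | J n w = j] =
    T @^-1` [set` `[j%:R / n.+1%:R, j.+1%:R / n.+1%:R[ ].
  apply/seteqP; split=> w /=; rewrite in_itv/= ler_pdivrMr// ltr_pdivlMr//.
    by move=> <-.
  move=> H; apply/eqP; rewrite Num.Theory.truncn_eq// mulr_ge0//.
have mT (B : set R) : measurable B -> measurable (T @^-1` B).
  exact: measurable_funPTI.
have mJ n j : measurable [set w | J n w = j] by rewrite JE; exact: mT.
have mN u : measurable [set w | N u w = k].
  exact: (measurable_funPTI (N u) (Y := [set k])).
have step n := @probability_at_nat_time _ _ _ P (J n)
  (fun j => [set w | N (g n j) w = k]) (f \o g n) (mJ n) (fun j => mN (g n j)).
have {}step n : measurable [set w | N (g n (J n w)) w = k] /\
    P [set w | N (g n (J n w)) w = k] = (\int[P]_w (f (g n (J n w)))%:E)%E.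
  apply: step => j /=; first by case/andP: (f01 _ (ltW (g0 n j))).
  by rewrite JE indep.
pose B n := [set w | N (g n (J n w)) w = k].
pose B' := [set w | N (T w) w = k].
have BE w : \forall n \near \oo, B n w <-> B' w.
  have H : \forall n \near \oo, T w < g n (J n w) -> N (g n (J n w)) w = N (T w) w.
    exact: (gcvg w _ (Nright (T w) w (T0 w))).
  apply: filterS H => n /(_ (gT n w)) NE.
  by rewrite /B /B'/= NE.
have mB n : measurable (B n) by case: (step n).
have mB' : measurable B'.
  (* Membership in [B n] is eventually that in [B'], so [B'] is the lower limit of measurable
     sets. *)
  have -> : B' = \bigcup_m \bigcap_(n in [set n | (m <= n)%N]) B n.
    apply/seteqP; split=> [w Bw|w [m _ Bw]].
      have [m _ H] := BE w; exists m => // n mn.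
      by apply/(H n mn).
    have [m' _ H] := BE w; apply/(H (maxn m m')); first exact: leq_maxr.
    by apply: Bw; exact: leq_maxl.
  apply: bigcup_measurable => m _.
  by apply: bigcap_measurable => //; exists m => /=.
have int1 : P.-integrable setT (EFin \o cst (1 : R)).
  exact: finite_measure_integrable_cst.
have lim1 : (\int[P]_w (\1_(B n) w)%:E)%E @[n --> \oo] --> (\int[P]_w (\1_B' w)%:E)%E.
  apply: (@dominated_cvg _ _ _ P setT measurableT _ _ (EFin \o cst (1 : R))) => //.
  - by move=> n; apply/measurable_EFinP; exact: measurable_indic.
  - move=> w _; apply: cvg_near_cst; apply: filterS (BE w) => n BB.
    by congr EFin; rewrite !indicE; suff -> : (w \in B n) = (w \in B') by [];
      apply/idP/idP; rewrite !inE => /BB.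
  - by move=> n w _ /=; rewrite lee_fin indicE; case: (_ \in _); rewrite ?normr1 ?normr0.
have lim2 : (\int[P]_w (f (g n (J n w)))%:E)%E @[n --> \oo] --> (\int[P]_w (f (T w))%:E)%E.
  apply: (@dominated_cvg _ _ _ P setT measurableT _ _ (EFin \o cst (1 : R))) => //.
  - move=> n; apply/measurable_EFinP.
    by apply: (measurableT_comp (f := f \o g n)) => //; exact: measurable_fun_nat.
  - by move=> w _; apply: cvg_EFin; [exact: nearW|apply: continuous_cvg (gcvg w); exact: fcont].
  - move=> n w _ /=; rewrite lee_fin; have /andP[f0 f1] := f01 _ (ltW (g0 n (J n w))).
    by rewrite ger0_norm.
have -> : P B' = (\int[P]_w (\1_B' w)%:E)%E by rewrite integral_indic// setIT.
apply: cvg_unique lim1 _ => //.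
rewrite (_ : (fun n => _) = (fun n => (\int[P]_w (f (g n (J n w)))%:E)%E))//.
apply/funext => n; rewrite integral_indic// setIT.
exact: (step n).2.
Qed.

(** * Law at a fixed time, Laplace transform and conclusion *)

Lemma markov_one_step d (Omega : measurableType d) (R : realType)
    (P : probability Omega R) (E : set nat) (p : R -> nat -> nat -> R) (x0 : nat)
    (N : R -> {RV P >-> nat}) (u : R) (k : nat) :
  markov_property E p N -> P [set w | N 0 w = x0] = 1%E ->
  E x0 -> E k -> 0 < u -> P [set w | N u w = k] = (p u x0 k)%:E.
Proof.
move=> markov N0 Ex0 Ek u0.
(* Only the times 0 and [u] enter the Markov property for [n = 0]. *)
have /= := markov 0%N (fun m => if m is 0%N then 0 else u) (fun m => if m is 0%N then x0 else k).
rewrite lexx subr0 => /(_ isT) H.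
have mN v j : measurable [set w | N v w = j].
  exact: (measurable_funPTI (N v) (Y := [set j])).
(* Intersecting with the almost sure initial event leaves the probability unchanged. *)
have -> : P [set w | N u w = k] = P ([set w | N 0 w = x0] `&` [set w | N u w = k]).
  rewrite setIC (measureDI P (mN u k) (mN 0 x0)).
  have NC : P (~` [set w | N 0 w = x0]) = 0%E by rewrite probability_setC// N0 subee.
  rewrite [X in (X + _)%E](_ : _ = 0%E) ?add0e//.
  apply: subset_measure0 NC; first exact: measurableD.
    exact: measurableC.
  by move=> w [].
have -> : [set w | N 0 w = x0] `&` [set w | N u w = k] =
    [set w | forall m, (m <= 1)%N ->
       N (if m is 0%N then 0 else u) w = if m is 0%N then x0 else k].
  apply/seteqP; split=> [w [/= H0 H1] [|m]//|w /= H1].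
  by split; [exact: (H1 0%N)|exact: (H1 1%N)].
rewrite H.
- rewrite (_ : [set w | _] = [set w | N 0 w = x0]) ?N0 ?mul1e//.
  by apply/seteqP; split=> [w /(_ 0%N isT)//|w Nw [|]].
- by case.
- by case.
Qed.

(** The integral against the law is pulled back to [Omega]; as [S t] is nonnegative, the half-line
    has full preimage. *)
Lemma laplace_stable d (Omega : measurableType d) (R : realType)
    (P : probability Omega R) (alpha : R) (S : R -> {RV P >-> R}) (t mu : R) :
  is_stable_time alpha S -> 0 < t -> 0 < mu ->
  (\int[P]_w (expR (- (mu * S t w)))%:E = (expR (- (t * mu `^ alpha)))%:E)%E.
Proof.
move=> [S0 laplace] t0 mu0; apply: etrans (laplace t mu t0 mu0).
rewrite ge0_integral_pushforward//.
- have -> : S t @^-1` `[0, +oo[ = setT.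
    by rewrite -subTset => w _ /=; rewrite in_itv/= andbT S0// ltW.
  by [].
- apply/measurable_EFinP; apply: measurableT_comp => //.
  by apply: measurableT_comp => //; exact: measurable_funM.
Qed.

Theorem theorem2p8 (d : measure_display) (Omega : measurableType d)
    (R : realType) (P : probability Omega R)
    (lambda : nat -> R)
    (lambda_gt0 : forall k, (1 <= k)%N -> 0 < lambda k)
    (lambda_distinct : forall i j, (1 <= i)%N -> (1 <= j)%N ->
       i <> j -> lambda i <> lambda j)
    (lambda_non_explosive : non_explosive lambda)
    (N : R -> {RV P >-> nat}) (N_birth : is_pure_birth_process lambda N)
    (alpha : R) (alpha_gt0 : 0 < alpha) (alpha_le1 : alpha <= 1)
    (S : R -> {RV P >-> R}) (S_stable : is_stable_time alpha S)
    (S_N_independent : independent_processes P S N)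
    (t : R) (t_gt0 : 0 < t) (k : nat) (k_ge1 : (1 <= k)%N) :
  P [set w | N (S t w) w = k] =
  (if (1 < k)%N then
     (\prod_(1 <= j < k) lambda j) *
     \sum_(1 <= m < k.+1)
        (expR (- (t * (lambda m) `^ alpha)) /
         \prod_(1 <= l < k.+1 | l != m) (lambda l - lambda m))
   else expR (- (t * (lambda 1%N) `^ alpha)))%:E.
Proof.
have [_ Nright N0 [p [ptf pgen markov]]] := N_birth.
have pE u : 0 <= u -> p u 1%N k = birth_prob lambda k u.
  exact: (birth_transitionE lambda_gt0 lambda_distinct ptf pgen).
have [S0 _] := S_stable.
rewrite (@probability_time_change _ _ _ P N (S t) (birth_prob lambda k)); last 5 first.
- by move=> w; rewrite S0// ltW.
- by move=> u w u0; exact: Nright.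
- exact: birth_prob_continuous.
(* The bounds 0 and 1 are hidden in the exponential sum; they come from the transition probability
   equal to it. *)
- move=> u u0; rewrite -pE//.
  by rewrite (transition_ge0 ptf)// (transition_le1 ptf).
- move=> u B u0 mB; rewrite S_N_independent; last 2 first.
  + by apply: sub_sigma_algebra; exists t, B; split => //; exact: ltW.
  + by apply: sub_sigma_algebra; exists u, [set k]; split => //; exact: ltW.
  by rewrite (markov_one_step markov N0)// pE// ltW.
(* The index is shifted as by [big_add1] below, so that every rate involved is positive. *)
have mexp m : measurable_fun setT (fun w => expR (- (lambda m.+1 * S t w))).
  apply: measurableT_comp => //; apply: measurableT_comp => //.
  exact: measurable_funM.
have int_exp m : P.-integrable setT (fun w => (expR (- (lambda m.+1 * S t w)))%:E).
  apply: measurable_bounded_integrable => //.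
    by rewrite (le_lt_trans (probability_le1 _ _))// ltry.
  exists 1; split => // M M1 w _ /=; apply: le_trans (ltW M1).
  rewrite ger0_norm ?expR_ge0// -[leRHS]expR0 ler_expR oppr_le0 mulr_ge0//.
    by rewrite ltW// lambda_gt0.
  by rewrite S0// ltW.
transitivity ((\sum_(1 <= m < k.+1)
    birth_coef lambda k m * expR (- (t * lambda m `^ alpha)))%:E).
  under eq_integral do rewrite /birth_prob big_add1 -sumEFin.
  rewrite integral_sum//; last first.
    by move=> m; under eq_fun do rewrite EFinM; exact: integrableZl.
  rewrite [in RHS]big_add1 -sumEFin; apply: eq_bigr => m _.
  under eq_integral do rewrite EFinM.
  by rewrite integralZl// (laplace_stable S_stable)// lambda_gt0.
congr EFin; have [k1|] := ltnP.
  rewrite mulr_sumr; apply: eq_bigr => m _.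
  by rewrite /birth_coef /node_prod [in RHS]mulrCA mulrC mulrA.
move=> k1; have {k1 k_ge1} -> : k = 1%N by apply/eqP; rewrite eqn_leq k1.
by rewrite big_nat1 /birth_coef /node_prod big_geq// big_mkcond big_nat1 eqxx invr1 !mul1r.
Qed.
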